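(* Let $D_1$ be an even delta-matroid on $E_1$ having no singular elements and let $D_2$ be an even delta-matroid on $E_2$ with non-singular element $e$. Let $D$ denote their tensor product $D_1\otimes_e D_2$, and let $E=E(D)$. Then \[ R(D;x+1,y+1)=q^{|E_1|}\Big(\frac{p}{q\sqrt{xy}}\Big)^{\sigma(D_1)}\sqrt{x}^{\,2\sigma(D)-|E|}\,\sqrt{xy}^{\,r((D_1)_{\min})-r(D_{\min})}\cdot R\Big(D_1;\frac{q\sqrt{xy}}{p}+1,\frac{p\sqrt{xy}}{q}+1\Big),\] where $p$ and $q$ are the unique solutions in the ring $\mathbb Z[\sqrt x,\sqrt y]$ to the equations \begin{align*} R(D_2/e;x+1,y+1)&=\sqrt{x}^{\,r((D_2/e)_{\max})-|E_2|+1}\sqrt{y}^{\,-r((D_2/e)_{\min})}\,(p\sqrt{xy}+q),\\ R(D_2\backslash e;x+1,y+1)&=\sqrt{x}^{\,r((D_2\backslash e)_{\max})-|E_2|+1}\sqrt{y}^{\,-r((D_2\backslash e)_{\min})}\,(p+q\sqrt{xy}). \end{align*}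
   Context: A delta-matroid is a pair $D=(E,\mathcal F)$ with $E$ a finite set (ground set, also written $E(D)$; $D$ is said to be on $E$) and $\mathcal F$ a non-empty collection of subsets of $E$ (feasible sets) such that for all $X,Y\in\mathcal F$ and $u\in X\bigtriangleup Y$ there is $v\in X\bigtriangleup Y$ (possibly $v=u$) with $X\bigtriangleup\{u,v\}\in\mathcal F$. It is even if all feasible sets have cardinalities of the same parity. A coloop is an element in every feasible set; a loop is an element in no feasible set. An isomorphism of delta-matroids is a bijection of ground sets preserving feasible sets. An element $e$ is singular if it is a coloop, or a loop, or $F\bigtriangleup\{e\}$ is feasible for every feasible set $F$ (in an even delta-matroid, singular elements are exactly the loops and coloops). If $e$ is not a coloop, $D\backslash e=(E-\{e\},\{F\in\mathcal F:e\notin F\})$. If $e$ is not a loop, $D/e=(E-\{e\},\{F-\{e\}:F\in\mathcal F,\ e\in F\})$. If $e$ is a loop or coloop, whichever of $D\backslash e$, $D/e$ is so far undefined is set equal to the other. For $B\subseteq E$, $D\backslash B$ is obtained by deleting the elements of $B$ one at a time (in any order). Two-sum of even delta-matroids: if $D_1=(E_1,\mathcal F_1)$, $D_2=(E_2,\mathcal F_2)$ are even with $E_1\cap E_2=\{f\}$ and $f$ non-singular in both, then $D_1\oplus_2 D_2$ is the (even) delta-matroid with ground set $(E_1\cup E_2)-\{f\}$ and feasible sets $\{(F_1\cup F_2)-\{f\}:F_1\in\mathcal F_1,\ F_2\in\mathcal F_2,\ f\text{ belongs to exactly one of }F_1,F_2\}$. Tensor product: let $D_1$ be an even delta-matroid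 on $E_1$ in which every element is non-singular and $D_2$ an even delta-matroid with non-singular element $e$. Let $\{D_f:f\in E_1\}$ be delta-matroids with pairwise disjoint ground sets, $E_1\cap E(D_f)=\{f\}$ for every $f\in E_1$, and such that for each $f$ there is an isomorphism from $D_f$ to $D_2$ mapping $f$ to $e$. The tensor product $D_1\otimes_e D_2$ is the delta-matroid obtained from $D_1$ by successively forming the two-sum with $D_f$ along $f$ for every $f\in E_1$; the order does not matter and the result is determined up to isomorphism by $D_1$, $D_2$ and $e$. For a delta-matroid $D=(E,\mathcal F)$, let $\mathcal F_{\max}$ and $\mathcal F_{\min}$ be the sets of feasible sets of maximum and minimum cardinality; $D_{\max}=(E,\mathcal F_{\max})$ and $D_{\min}=(E,\mathcal F_{\min})$ are matroids given by their bases, and $r(\cdot)$ denotes matroid rank (so $r(D_{\max})$, $r(D_{\min})$ are the maximum and minimum sizes of feasible sets). Put $\sigma(D)=\tfrac12(r(D_{\min})+r(D_{\max}))$, and for $A\subseteq E$, $\sigma_D(A)=\sigma(D\backslash(E-A))$, written $\sigma(A)$. The Tutte polynomial of $D$ is \[R(D;x,y)=\sum_{A\subseteq E}(x-1)^{\sigma(E)-\sigma(A)}(y-1)^{|A|-\sigma(A)}.\] For even $D$ all exponents are non-negative integers. Here $\sqrt x,\sqrt y$ are formal square roots (indeterminates whose squares are $x,y$), $\sqrt{xy}=\sqrt x\sqrt y$, and the main identity is in the field of fractions of $\mathbb Z[\sqrt x,\sqrt y]$. *)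

(* Defs.v *)
From HB Require Import structures.
From mathcomp Require Import all_boot all_order all_algebra.
From mathcomp Require Import mpoly.

Set Implicit Arguments.
Unset Strict Implicit.
Unset Printing Implicit Defensive.

Import GRing.Theory.
Local Open Scope ring_scope.

(* A ground set together with a family of subsets of it, inside an ambient
   finite type.  The operations below are defined on all set systems; the
   delta-matroid axioms are the separate predicate [delta_matroid]. *)
Record set_system (T : finType) := SetSystem {
  ground : {set T};
  feasible : {set {set T}}
}.

Section DeltaMatroid.
Variable T : finType.
Implicit Types (D : set_system T) (e f : T) (A B X Y F : {set T}).

Definition symdiff A B : {set T} := (A :\: B) :|: (B :\: A).

Definition delta_matroid D : Prop :=
  [/\ feasible D != set0,
      forall F, F \in feasible D -> F \subset ground D
    & forall X Y u, X \in feasible D -> Y \in feasible D ->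
        u \in symdiff X Y ->
        exists2 v, v \in symdiff X Y & symdiff X [set u; v] \in feasible D].

Definition even_delta_matroid D : Prop :=
  delta_matroid D /\
  forall X Y, X \in feasible D -> Y \in feasible D -> odd #|X| = odd #|Y|.

Definition coloop D e : bool :=
  (e \in ground D) && [forall F in feasible D, e \in F].

Definition loop D e : bool :=
  (e \in ground D) && [forall F in feasible D, e \notin F].

Definition singular D e : bool :=
  (e \in ground D) &&
  [|| coloop D e, loop D e
    | [forall F in feasible D, symdiff F [set e] \in feasible D]].

Definition nonsingular D e : bool := (e \in ground D) && ~~ singular D e.

Definition plain_delete D e : set_system T :=
  SetSystem (ground D :\ e) [set F in feasible D | e \notin F].

Definition plain_contract D e : set_system T :=
  SetSystem (ground D :\ e) [set F :\ e | F in feasible D & e \in F].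

Definition delete D e : set_system T :=
  if coloop D e then plain_contract D e else plain_delete D e.

Definition contract D e : set_system T :=
  if loop D e then plain_delete D e else plain_contract D e.

(* The elements of B are deleted one at a time, in the order of [enum B]; for
   a delta-matroid the order is immaterial. *)
Definition delete_set D B : set_system T := foldl delete D (enum B).

Definition dm_max D : set_system T :=
  SetSystem (ground D)
    [set F in feasible D | [forall G in feasible D, #|G| <= #|F|]%N].

Definition dm_min D : set_system T :=
  SetSystem (ground D)
    [set F in feasible D | [forall G in feasible D, #|F| <= #|G|]%N].

(* Rank of a matroid given by its bases, which all have the same size. *)
Definition rank (M : set_system T) : nat := \max_(B in feasible M) #|B|.

(* The halving is exact when D is even, since then the two ranks have the same
   parity; only even delta-matroids (whose minors are even) are considered. *)
Definition sigma D : nat := (rank (dm_min D) + rank (dm_max D))./2.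

Definition sigma_on D A : nat := sigma (delete_set D (ground D :\: A)).

(* R(D; x, y) at a point of a field.  The exponents are differences taken in
   int; for even D they are nonnegative. *)
Definition tutte (K : fieldType) D (x y : K) : K :=
  \sum_(A in powerset (ground D))
     (x - 1) ^ ((sigma D)%:Z - (sigma_on D A)%:Z) *
     (y - 1) ^ (#|A|%:Z - (sigma_on D A)%:Z).

(* Meant for ground sets that meet exactly in f. *)
Definition two_sum (D1 D2 : set_system T) f : set_system T :=
  SetSystem ((ground D1 :|: ground D2) :\ f)
    [set (F1 :|: F2) :\ f | F1 in feasible D1, F2 in feasible D2
                          & (f \in F1) (+) (f \in F2)].

End DeltaMatroid.

(* phi : T -> U restricts to an isomorphism from D to D'. *)
Definition dm_isomorphism (T U : finType) (D : set_system T)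
    (D' : set_system U) (phi : T -> U) : Prop :=
  [/\ {in ground D &, injective phi},
      phi @: ground D = ground D'
    & forall F : {set T}, F \subset ground D ->
        (F \in feasible D) = (phi @: F \in feasible D')].

(* D is the tensor product of D1 and D2 along e, for some choice of the copies
   Df f of D2 and of the order s in which the two-sums are formed. *)
Definition is_tensor_product (T U : finType) (D1 : set_system T)
    (D2 : set_system U) (e : U) (D : set_system T) : Prop :=
  exists (Df : T -> set_system T) (s : seq T),
    [/\ forall f, f \in ground D1 ->
          [/\ delta_matroid (Df f),
              ground D1 :&: ground (Df f) = [set f]
            & exists2 phi : T -> U, dm_isomorphism (Df f) D2 phi & phi f = e],
        {in ground D1 &, forall f g, f != g ->
          [disjoint ground (Df f) & ground (Df g)]},
        perm_eq s (enum (ground D1))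
      & D = foldl (fun D' f => two_sum D' (Df f) f) D1 s].

(* Z[sqrt x, sqrt y] and its field of fractions. *)
Notation Zxy := {mpoly int[2]}.
Notation Qxy := {fraction {mpoly int[2]}}.

Definition emb : Zxy -> Qxy := @tofrac _.

Definition sqx : Qxy := emb 'X_0.
Definition sqy : Qxy := emb 'X_1.
Definition sqxy : Qxy := sqx * sqy.

Definition tutte1 (T : finType) (D : set_system T) : Qxy :=
  tutte D (sqx ^+ 2 + 1) (sqy ^+ 2 + 1).

Definition pq_equations (U : finType) (D2 : set_system U) (e : U)
    (p q : Zxy) : Prop :=
  tutte1 (contract D2 e) =
    sqx ^ ((rank (dm_max (contract D2 e)))%:Z - #|ground D2|%:Z + 1) *
    sqy ^ (- (rank (dm_min (contract D2 e)))%:Z) *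
    (emb p * sqxy + emb q)
  /\
  tutte1 (delete D2 e) =
    sqx ^ ((rank (dm_max (delete D2 e)))%:Z - #|ground D2|%:Z + 1) *
    sqy ^ (- (rank (dm_min (delete D2 e)))%:Z) *
    (emb p + emb q * sqxy).

(* Main.v *)
(* Put d(A) = min |F symdiff A| over the feasible sets F.  The exchange axiom
   shows that deleting e outside A preserves d(A) - d(set0), whence
   2 sigma(A) = |A| - d(A) + d(set0), and R(D) becomes, up to a monomial, the
   transition polynomial sum_A a^|E - A| b^|A| t^d(A) with t = a b.  For a
   non-singular e of an even D2 the values of d(A) in D2 \ e and D2 / e differ
   by exactly 1, and p and q collect the sets A for which the deletion, resp.
   the contraction, has the smaller value: q + t p and p + t q are then the
   transition polynomials of D2 / e and D2 \ e.  Letting the weights a and b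
   depend on the element, a two-sum along f replaces the weights of f by q and
   p, so the transition polynomial of the tensor product is that of D1 at
   (q, p). *)
Require Import Defs.
From HB Require Import structures.
From mathcomp Require Import all_boot all_order all_algebra.
From mathcomp Require Import mpoly.
From mathcomp Require Import zify ring.

Set Implicit Arguments.
Unset Strict Implicit.
Unset Printing Implicit Defensive.

Import GRing.Theory.
Local Open Scope ring_scope.

(** * Distance from a set to the nearest feasible set, and the two ranks *)

Section Distance.
Variable T : finType.
Implicit Types (D : set_system T) (e f g : T) (A B F X Y : {set T}).

Lemma in_symdiff A B x : (x \in symdiff A B) = (x \in A) (+) (x \in B).
Proof. by rewrite !inE; case: (x \in A); case: (x \in B). Qed.

Lemma symdiffs0 A : symdiff A set0 = A.
Proof. by apply/setP => x; rewrite in_symdiff inE addbF. Qed.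

Lemma card_symdiff_notin A F e : e \notin A ->
  #|symdiff F A| = (#|symdiff (F :\ e) A| + (e \in F))%N.
Proof.
move=> eA; rewrite (cardsD1 e (symdiff F A)) in_symdiff (negbTE eA) addbF addnC.
congr (_ + _)%N; apply: eq_card => x; rewrite !(in_symdiff, inE).
by case: eqP => [->|//]; rewrite (negbTE eA).
Qed.

Lemma card_symdiff_setU1 A F e : e \notin A ->
  #|symdiff F (e |: A)| = (#|symdiff (F :\ e) A| + (e \notin F))%N.
Proof.
move=> eA; rewrite (cardsD1 e (symdiff F _)) in_symdiff setU11 addbT addnC.
congr (_ + _)%N; apply: eq_card => x; rewrite !(in_symdiff, inE).
by case: eqP => [->|//]; rewrite (negbTE eA).
Qed.

Lemma card_symdiff_set1 A v : (#|symdiff A [set v]| <= #|A| + 1)%N.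
Proof.
apply: leq_trans (leq_card_setU _ _) _; rewrite -[X in (_ <= _ + X)%N](cards1 v).
by apply: leq_add; apply/subset_leq_card/subsetDl.
Qed.

(** Dropping [e], which lies in [F] but not in [A], saves one; toggling [v] costs at most one. *)
Lemma card_symdiff_pair A F e v : e \notin A -> e \in F -> v != e ->
  (#|symdiff (symdiff F [set e; v]) A| <= #|symdiff F A|)%N.
Proof.
move=> eA eF ve; rewrite [in leqRHS](card_symdiff_notin _ eA) eF.
have -> : symdiff (symdiff F [set e; v]) A = symdiff (symdiff (F :\ e) A) [set v].
  apply/setP => x; rewrite !(in_symdiff, inE).
  case: (x =P e) => [->|_]; last by rewrite addbAC.
  by rewrite eF (negbTE eA) eq_sym (negbTE ve).
exact: card_symdiff_set1.
Qed.

(** The exchange adds [e] to [F] and the contraction removes it again, so only the toggling of [v]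
    is felt. *)
Lemma card_symdiff_pair_notin A F e v : e \notin A -> e \notin F -> v != e ->
  (#|symdiff (symdiff F [set e; v] :\ e) A| <= #|symdiff F A|.+1)%N.
Proof.
move=> eA eF ve.
have -> : symdiff (symdiff F [set e; v] :\ e) A = symdiff (symdiff F A) [set v].
  apply/setP => x; rewrite !(in_symdiff, inE).
  case: (x =P e) => [->|_]; last by rewrite addbAC.
  by rewrite (negbTE eF) (negbTE eA) eq_sym (negbTE ve).
by rewrite -addn1; exact: card_symdiff_set1.
Qed.

Lemma odd_symdiff A B : odd #|symdiff A B| = odd #|A| (+) odd #|B|.
Proof.
have d : [disjoint A :\: B & B :\: A].
  by rewrite -setI_eq0; apply/eqP/setP => x; rewrite !inE; do 2 case: (_ \in _).
have := cardsID B A; have := cardsID A B; rewrite (setIC B A) => <- <-.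
rewrite (eqTleqif (leq_card_setU _ _) d) !oddD.
by case: (odd #|A :&: B|); case: (odd #|A :\: B|); case: (odd #|B :\: A|).
Qed.

(** The minimum of [#|symdiff F A|] over feasible [F], encoded through complements because [\max]
    has a neutral default: with no feasible set the value is [#|T|]. *)
Definition dist D A : nat :=
  (#|T| - \max_(F in feasible D) (#|T| - #|symdiff F A|))%N.

Lemma dist_le D A F : F \in feasible D -> (dist D A <= #|symdiff F A|)%N.
Proof.
move=> FD; rewrite /dist.
have : (#|T| - #|symdiff F A| <=
    \max_(F in feasible D) (#|T| - #|symdiff F A|))%N.
  exact: (leq_bigmax_cond (F := fun F => (#|T| - #|symdiff F A|)%N)).
by have := max_card (mem (symdiff F A)); lia.
Qed.

Lemma dist_attained D A : feasible D != set0 ->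
  exists2 F, F \in feasible D & dist D A = #|symdiff F A|.
Proof.
case/set0Pn => F0 F0D.
have ne : (0 < #|feasible D|)%N by apply/card_gt0P; exists F0.
have [F FD mF] := eq_bigmax_cond (fun F => #|T| - #|symdiff F A|)%N ne.
exists F => //; rewrite /dist mF /=.
by rewrite subKn ?max_card.
Qed.

Lemma dist_eq D A F : F \in feasible D ->
  (forall G, G \in feasible D -> (#|symdiff F A| <= #|symdiff G A|)%N) ->
  dist D A = #|symdiff F A|.
Proof.
move=> FD minF; apply/eqP; rewrite eqn_leq dist_le //=.
have ne : feasible D != set0 by apply/set0Pn; exists F.
by have [G GD ->] := dist_attained A ne; apply: minF.
Qed.

Lemma rank_min D : feasible D != set0 -> rank (dm_min D) = dist D set0.
Proof.
move=> ne; have [F FD eF] := dist_attained set0 ne.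
have minF G : G \in feasible D -> (#|F| <= #|G|)%N.
  by move=> GD; have := dist_le set0 GD; rewrite eF !symdiffs0.
rewrite eF symdiffs0; apply/eqP; rewrite eqn_leq; apply/andP; split.
  apply/bigmax_leqP => B; rewrite !inE => /andP [BD /forall_inP mB].
  exact: mB.
apply: (leq_bigmax_cond (F := fun B : {set T} => #|B|)); rewrite !inE FD.
exact/forall_inP.
Qed.

Lemma card_symdiff_ground A B : A \subset B -> (#|A| + #|symdiff A B|)%N = #|B|.
Proof.
move=> sAB; rewrite /symdiff (eqP (_ : A :\: B == set0)) ?setD_eq0 // set0U.
by rewrite cardsDS //; have := subset_leq_card sAB; lia.
Qed.

(** A feasible [F] lies in the ground set [E], so [#|symdiff F E| = #|E| - #|F|]: the largest
    feasible sets are those nearest to [E]. *)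
Lemma rank_max D : feasible D != set0 ->
  (forall F, F \in feasible D -> F \subset ground D) ->
  (rank (dm_max D) + dist D (ground D))%N = #|ground D|.
Proof.
move=> ne sub; have [F FD eF] := dist_attained (ground D) ne.
have maxF G : G \in feasible D -> (#|G| <= #|F|)%N.
  move=> GD; have := dist_le (ground D) GD; rewrite eF.
  have := card_symdiff_ground (sub _ GD); have := card_symdiff_ground (sub _ FD).
  by lia.
rewrite eF -(card_symdiff_ground (sub _ FD)); congr (_ + _)%N.
apply/eqP; rewrite eqn_leq; apply/andP; split.
  by apply/bigmax_leqP => B; rewrite !inE => /andP [BD _]; apply: maxF.
apply: (leq_bigmax_cond (F := fun B : {set T} => #|B|)); rewrite !inE FD.
exact/forall_inP.
Qed.

End Distance.

(** * Deletion and contraction in even delta-matroids, and their effect on the distance *)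

Section Minors.
Variable T : finType.
Implicit Types (D : set_system T) (e f g : T) (A B F X Y : {set T}).

(** With [v = u] the exchange would change the cardinality by one, hence its parity. *)
Lemma even_dm_neq D X u v : even_delta_matroid D -> X \in feasible D ->
  symdiff X [set u; v] \in feasible D -> v != u.
Proof.
move=> [_ ev] XD XuvD; apply/eqP => vu; move: (ev _ _ XD XuvD).
by rewrite odd_symdiff vu setUid cards1 addbT; case: odd.
Qed.

Lemma plain_delete_even D e : even_delta_matroid D ->
  (exists2 F, F \in feasible D & e \notin F) ->
  even_delta_matroid (plain_delete D e).
Proof.
move=> [[ne sub ex] ev] [F0 F0D eF0]; split; last first.
  by move=> X Y; rewrite !inE => /andP [XD _] /andP [YD _]; apply: ev.
split.
- by apply/set0Pn; exists F0; rewrite inE F0D.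
- move=> F; rewrite inE => /andP [FD eF] /=.
  by rewrite subsetD1 sub.
move=> X Y u; rewrite !inE => /andP [XD eX] /andP [YD eY] uXY.
have [|v vXY XuvD] := ex X Y u XD YD; first by rewrite in_symdiff; move: uXY; do 2 case: (_ \in _).
exists v => //; rewrite inE XuvD in_symdiff (negbTE eX) !inE /=.
apply/norP; split; apply/eqP => E; first by move: uXY; rewrite -E (negbTE eX) (negbTE eY).
by move: vXY; rewrite -E in_symdiff (negbTE eX) (negbTE eY).
Qed.

Lemma plain_contract_even D e : even_delta_matroid D ->
  (exists2 F, F \in feasible D & e \in F) ->
  even_delta_matroid (plain_contract D e).
Proof.
move=> [[ne sub ex] ev] [F0 F0D eF0].
have feasP X : X \in feasible (plain_contract D e) ->
    exists F, [/\ F \in feasible D, e \in F & X = F :\ e].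
  by case/imsetP => F; rewrite inE => /andP [FD eF] ->; exists F.
split; last first.
  move=> X Y /feasP [F [FD eF ->]] /feasP [G [GD eG ->]].
  have := ev _ _ FD GD; rewrite (cardsD1 e F) (cardsD1 e G) eF eG /=.
  by move/negb_inj.
split.
- by apply/set0Pn; exists (F0 :\ e); apply: imset_f; rewrite inE F0D.
- by move=> X /feasP [F [FD eF ->]] /=; apply: setSD; apply: sub.
move=> X Y u /feasP [F [FD eF ->]] /feasP [G [GD eG ->]].
have E : symdiff (F :\ e) (G :\ e) = symdiff F G.
  apply/setP => x; rewrite !(in_symdiff, inE).
  by case: eqP => // ->; rewrite eF eG.
rewrite E => uFG; have [v vFG FuvD] := ex F G u FD GD uFG.
have neq w : w \in symdiff F G -> e == w = false.
  by move=> wFG; apply/eqP => ew; move: wFG; rewrite in_symdiff -ew eF eG.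
exists v => //; apply/imsetP; exists (symdiff F [set u; v]).
  by rewrite inE FuvD in_symdiff eF !inE !neq.
apply/setP => x; rewrite !(in_symdiff, inE).
by case: eqP => // ->; rewrite !neq.
Qed.

Lemma delete_even D e : even_delta_matroid D -> e \in ground D ->
  even_delta_matroid (delete D e).
Proof.
move=> evD eD; rewrite /delete /coloop eD /=.
case: ifP => [/forall_inP ce|/negbT /forall_inPn [F FD eF]].
  apply: plain_contract_even => //; case: evD => [[/set0Pn [F FD] _ _] _].
  by exists F => //; apply: ce.
by apply: plain_delete_even => //; exists F.
Qed.

Lemma ground_delete D e : ground (delete D e) = ground D :\ e.
Proof. by rewrite /delete; case: ifP. Qed.

Lemma dist_contract_attained D e A :
  (exists2 F, F \in feasible D & e \in F) ->
  exists F, [/\ F \in feasible D, e \in F &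
    dist (plain_contract D e) A = #|symdiff (F :\ e) A|].
Proof.
move=> [F0 F0D eF0].
have [|X /imsetP [F]] := @dist_attained _ (plain_contract D e) A.
  by apply/set0Pn; exists (F0 :\ e); apply: imset_f; rewrite inE F0D.
by rewrite inE => /andP [FD eF] -> ->; exists F.
Qed.

Lemma dist_delete_attained D e A :
  (exists2 F, F \in feasible D & e \notin F) ->
  exists F, [/\ F \in feasible D, e \notin F &
    dist (plain_delete D e) A = #|symdiff F A|].
Proof.
move=> [F0 F0D eF0].
have [|F] := @dist_attained _ (plain_delete D e) A.
  by apply/set0Pn; exists F0; rewrite inE F0D.
by rewrite inE => /andP [FD eF] ->; exists F.
Qed.

Lemma dist_contract_le D e A F : F \in feasible D -> e \in F ->
  (dist (plain_contract D e) A <= #|symdiff (F :\ e) A|)%N.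
Proof. by move=> FD eF; apply: dist_le; apply: imset_f; rewrite inE FD. Qed.

Lemma dist_delete_le D e A F : F \in feasible D -> e \notin F ->
  (dist (plain_delete D e) A <= #|symdiff F A|)%N.
Proof. by move=> FD eF; apply: dist_le; rewrite inE FD. Qed.

(** If a nearest feasible set contains [e], exchanging at [e] towards a feasible set avoiding [e]
    yields one that avoids [e] and is no farther from [A]. *)
Lemma dist_plain_delete D e A : even_delta_matroid D ->
  (exists2 F, F \in feasible D & e \notin F) -> e \notin A ->
  dist (plain_delete D e) A = dist D A.
Proof.
move=> evD e0 eA; have [[ne sub ex] ev] := evD.
apply/eqP; rewrite eqn_leq; apply/andP; split; last first.
  by have [F [FD eF ->]] := dist_delete_attained A e0; apply: dist_le.
have [F FD ->] := dist_attained A ne.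
have [eF|eF] := boolP (e \in F); last exact: dist_delete_le.
have [G GD eG] := e0.
have [|v _ FevD] := ex F G e FD GD; first by rewrite in_symdiff eF (negbTE eG).
have ve := even_dm_neq evD FD FevD.
apply: leq_trans (card_symdiff_pair eA eF ve); apply: dist_delete_le => //.
by rewrite in_symdiff eF !inE eqxx.
Qed.

(** Here [e] belongs to every feasible set and not to [A], so it contributes exactly one to each
    distance. *)
Lemma dist_plain_contract D e A : feasible D != set0 ->
  (forall F, F \in feasible D -> e \in F) -> e \notin A ->
  (dist (plain_contract D e) A).+1 = dist D A.
Proof.
move=> ne ce eA; apply/eqP; rewrite eqn_leq; apply/andP; split.
  have [F FD ->] := dist_attained A ne.
  by rewrite (card_symdiff_notin _ eA) ce // addn1 ltnS dist_contract_le ?ce.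
have [|F [FD eF ->]] := @dist_contract_attained D e A.
  by case/set0Pn: ne => F FD; exists F; rewrite ?ce.
by apply: leq_trans (dist_le _ FD) _; rewrite (card_symdiff_notin _ eA) eF addn1.
Qed.

(* In an even delta-matroid the two sides have different parities, and the
   exchange axiom bounds their difference by 1. *)
Lemma dist_delete_contract D e A : even_delta_matroid D ->
  (exists2 F, F \in feasible D & e \notin F) ->
  (exists2 F, F \in feasible D & e \in F) -> e \notin A ->
  let d0 := dist (plain_delete D e) A in
  let d1 := dist (plain_contract D e) A in
  (d0 == d1.+1) || (d1 == d0.+1).
Proof.
move=> evD e0 e1 eA /=; set d0 := dist _ _; set d1 := dist _ _; have [[ne sub ex] ev] := evD.
have [F0 [F0D eF0 E0]] := dist_delete_attained A e0.
have [F1 [F1D eF1 E1]] := dist_contract_attained A e1.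
have par : odd d0 = ~~ odd d1.
  have := card_symdiff_notin F1 eA; rewrite eF1 addn1 /d0 /d1 E0 E1.
  move/(congr1 odd); rewrite /= odd_symdiff -(ev _ _ F0D F1D) -odd_symdiff.
  by [].
have le1 : (d1 <= d0.+1)%N.
  have [|v _ FevD] := ex F0 F1 e F0D F1D; first by rewrite in_symdiff eF1 (negbTE eF0).
  have ve := even_dm_neq evD F0D FevD.
  rewrite /d0 E0; apply: leq_trans (card_symdiff_pair_notin eA eF0 ve).
  by apply: dist_contract_le => //; rewrite in_symdiff (negbTE eF0) !inE eqxx.
have le0 : (d0 <= d1.+1)%N.
  have [|v _ FevD] := ex F1 F0 e F1D F0D; first by rewrite in_symdiff eF1 (negbTE eF0).
  have ve := even_dm_neq evD F1D FevD.
  (* The successor is rewritten as the indicator of [e \in F1], so that the right side becomes the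
     distance from [F1] itself to [A]. *)
  rewrite /d1 E1 -addn1 -[1%N]/(nat_of_bool true) -eF1 -(card_symdiff_notin F1 eA).
  apply: leq_trans (card_symdiff_pair eA eF1 ve); apply: dist_delete_le => //.
  by rewrite in_symdiff eF1 !inE eqxx.
by move: par le1 le0; move: d0 d1 => a b; lia.
Qed.

(** Deleting a coloop lowers both distances by one, and any other deletion leaves both unchanged.
    The additive form avoids truncated subtraction. *)
Lemma dist_delete D e A : even_delta_matroid D -> e \in ground D -> e \notin A ->
  (dist (delete D e) A + dist D set0 = dist D A + dist (delete D e) set0)%N.
Proof.
move=> evD eD eA; have [[ne _ _] _] := evD.
have e0 : e \notin (set0 : {set T}) by rewrite inE.
rewrite /delete /coloop eD /=.
case: ifP => [/forall_inP ce|/negbT /forall_inPn [F FD eF]].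
  by rewrite -(dist_plain_contract ne ce eA) -(dist_plain_contract ne ce e0) addSnnS.
have x0 : exists2 F, F \in feasible D & e \notin F by exists F.
by rewrite !dist_plain_delete.
Qed.

(** The differences of distances telescope along the successive deletions; evenness is carried along
    because each single deletion needs it. *)
Lemma foldl_deleteP D s A : even_delta_matroid D -> uniq s ->
  {subset s <= ground D} -> {in s, forall x, x \notin A} ->
  let D' := foldl (@delete T) D s in
  [/\ even_delta_matroid D', ground D' = ground D :\: [set x in s] &
     (dist D' A + dist D set0 = dist D A + dist D' set0)%N].
Proof.
elim: s D => [|e s IH] D evD /=.
  by move=> _ _ _; split=> //; apply/setP => x; rewrite !inE.
case/andP => es us sD sA.
have eD : e \in ground D by apply: sD; rewrite mem_head.
have eA : e \notin A by apply: sA; rewrite mem_head.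
have [||x xs|x xs|ev' gr di] // := IH (delete D e).
- exact: delete_even.
- rewrite ground_delete !inE sD ?inE ?xs ?orbT // andbT.
  by apply: contraNneq es => <-.
- by apply: sA; rewrite inE xs orbT.
split=> //.
  by rewrite gr ground_delete; apply/setP => x; rewrite !inE negb_or andbA (andbC (x \notin s)).
by have := dist_delete evD eD eA; move: di; lia.
Qed.

(** The ranks are [dist D set0] and [#|E| - dist D E]. Both are sizes of feasible sets, so evenness
    makes their sum even and the halving in [sigma] exact. *)
Lemma double_sigma D : even_delta_matroid D ->
  ((sigma D).*2 + dist D (ground D) = #|ground D| + dist D set0)%N.
Proof.
move=> [[ne sub ex] ev]; rewrite -(rank_max ne sub) -(rank_min ne) /sigma.
suff /even_halfK -> : ~~ odd (rank (dm_min D) + rank (dm_max D)) by lia.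
have [F FD eF] := dist_attained set0 ne.
have [G GD eG] := dist_attained (ground D) ne.
have := rank_max ne sub; rewrite eG -(card_symdiff_ground (sub _ GD)).
move/eqP; rewrite eqn_add2r => /eqP ->.
by rewrite rank_min // eF symdiffs0 oddD (ev _ _ FD GD) addbb.
Qed.

(** The minor left after the deletions has ground set [A]; [double_sigma] applies to it, and the
    telescoped difference brings the distances back to [D]. *)
Lemma double_sigma_on D A : even_delta_matroid D -> A \subset ground D ->
  ((sigma_on D A).*2 + dist D A = #|A| + dist D set0)%N.
Proof.
move=> evD sA; rewrite /sigma_on /delete_set.
have [|x|x|ev' gr di] := @foldl_deleteP D (enum (ground D :\: A)) A evD.
- exact: enum_uniq.
- by rewrite mem_enum inE => /andP [].
- by rewrite mem_enum inE => /andP [].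
have grA : ground (foldl (@delete T) D (enum (ground D :\: A))) = A.
  rewrite gr; apply/setP => x; rewrite !inE mem_enum !inE negb_and negbK.
  by have := subsetP sA x; case: (x \in A) => [->//|_]; case: (x \in ground D).
have := double_sigma ev'; rewrite grA; move: di; lia.
Qed.

End Minors.

(** * Two-sums: evenness, the exchange axiom and the distance formula *)

Section TwoSum.
Variable T : finType.
Implicit Types (D : set_system T) (e f g : T) (A B F X Y : {set T}).

Lemma in_two_sum D1 D2 f F1 F2 : F1 \in feasible D1 -> F2 \in feasible D2 ->
  (f \in F1) (+) (f \in F2) -> (F1 :|: F2) :\ f \in feasible (two_sum D1 D2 f).
Proof.
by move=> F1D F2D fF; apply/imset2P; exists F1 F2; rewrite ?inE ?F2D.
Qed.

Lemma two_sum_feasibleP D1 D2 f F : F \in feasible (two_sum D1 D2 f) ->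
  exists F1 F2, [/\ F1 \in feasible D1, F2 \in feasible D2,
    (f \in F1) (+) (f \in F2) & F = (F1 :|: F2) :\ f].
Proof.
case/imset2P => F1 F2 F1D; rewrite inE => /andP [F2D fF] ->.
by exists F1, F2.
Qed.

Lemma two_sumC D1 D2 f : two_sum D1 D2 f = two_sum D2 D1 f.
Proof.
have sub D D' F : F \in feasible (two_sum D D' f) -> F \in feasible (two_sum D' D f).
  case/two_sum_feasibleP => F1 [F2 [F1D F2D fF ->]].
  by rewrite setUC; apply: in_two_sum => //; rewrite addbC.
rewrite {1 2}/two_sum setUC; congr SetSystem.
by apply/setP => F; apply/idP/idP; apply: sub.
Qed.

(** Exchange [u] in [D1] against some [v]. If [v != f], the part in [D2] is kept; if [v = f], the
    part in [D1] has changed its status at [f], and an exchange at [f] in [D2] restores the two-sum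
    condition and supplies the actual partner. *)
Lemma two_sum_exchange D1 D2 f X Y u :
  even_delta_matroid D1 -> even_delta_matroid D2 ->
  ground D1 :&: ground D2 = [set f] ->
  X \in feasible (two_sum D1 D2 f) -> Y \in feasible (two_sum D1 D2 f) ->
  u \in symdiff X Y -> u \in ground D1 ->
  exists2 v, v \in symdiff X Y &
    symdiff X [set u; v] \in feasible (two_sum D1 D2 f).
Proof.
move=> ev1 ev2 gf XD YD uXY u1.
have [X1 [X2 [X1D X2D fX eX]]] := two_sum_feasibleP XD.
have [Y1 [Y2 [Y1D Y2D fY eY]]] := two_sum_feasibleP YD.
have [[_ sub1 ex1] _] := ev1; have [[_ sub2 ex2] _] := ev2.
have out2 w F : w \in ground D1 -> w != f -> F \in feasible D2 -> w \in F = false.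
  move=> w1 wf FD; apply/negP => wF; move: (in_set1 w f).
  by rewrite -gf inE w1 (subsetP (sub2 _ FD)) // (negbTE wf).
have out1 w F : w \in ground D2 -> w != f -> F \in feasible D1 -> w \in F = false.
  move=> w1 wf FD; apply/negP => wF; move: (in_set1 w f).
  by rewrite -gf inE w1 (subsetP (sub1 _ FD)) // (negbTE wf).
have inX w F G : (w \in symdiff F G) -> [|| w \in F | w \in G].
  by rewrite in_symdiff; do 2 case: (w \in _).
have uf : u != f.
  by apply/eqP => uf; move: uXY; rewrite eX eY uf in_symdiff !inE eqxx.
have [|v vXY1 XuvD] := ex1 X1 Y1 u X1D Y1D.
  by move: uXY; rewrite eX eY !in_symdiff !inE uf (out2 u X2) ?(out2 u Y2) // !orbF.
have vu := even_dm_neq ev1 X1D XuvD.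
have v1 : v \in ground D1.
  by case/orP: (inX _ _ _ vXY1) => h; [apply: (subsetP (sub1 _ X1D))|apply: (subsetP (sub1 _ Y1D))].
have [vf|vf] := eqVneq v f.
  (* Since [f] lies in exactly one of [X1], [X2] and in exactly one of [Y1], [Y2], the sets [X2] and
     [Y2] differ at [f] as soon as [X1] and [Y1] do. *)
  have [|w wXY2 XfwD] := ex2 X2 Y2 f X2D Y2D.
    move: vXY1 fX fY; rewrite !in_symdiff vf.
    by do 4 case: (f \in _).
  have wf := even_dm_neq ev2 X2D XfwD.
  have w2 : w \in ground D2.
    by case/orP: (inX _ _ _ wXY2) => h;
      [apply: (subsetP (sub2 _ X2D))|apply: (subsetP (sub2 _ Y2D))].
  exists w.
    by move: wXY2; rewrite eX eY !in_symdiff !inE wf (out1 w X1) ?(out1 w Y1).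
  have -> : symdiff X [set u; w] =
      (symdiff X1 [set u; v] :|: symdiff X2 [set f; w]) :\ f.
    rewrite eX; apply/setP => x; rewrite !(in_setD1, in_symdiff, in_setU, in_set1) vf.
    have [->|xf] := eqVneq x f.
      by rewrite eq_sym (negbTE uf) eq_sym (negbTE wf).
    rewrite orbF /=; have [->|xu] := eqVneq x u.
      have uw : u == w = false.
        by apply/eqP => uw; move: (in_set1 u f); rewrite -gf inE u1 uw w2 -uw (negbTE uf).
      by rewrite (out2 u X2) // uw /=; case: (u \in X1).
    rewrite /=; have [->|xw] := eqVneq x w; last by rewrite !addbF.
    by rewrite (out1 w X1).
  apply: in_two_sum => //; move: fX.
  rewrite !in_symdiff !inE vf eqxx eq_sym (negbTE uf) /=.
  by do 2 case: (f \in _).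
exists v.
  by move: vXY1; rewrite eX eY !in_symdiff !inE vf (out2 v X2) ?(out2 v Y2) // !orbF.
have -> : symdiff X [set u; v] = (symdiff X1 [set u; v] :|: X2) :\ f.
  rewrite eX; apply/setP => x; rewrite !(in_setD1, in_symdiff, in_setU, in_set1).
  have [->|xf] := eqVneq x f.
    by rewrite eq_sym (negbTE uf) eq_sym (negbTE vf).
  have [->|xu] := eqVneq x u; first by rewrite (out2 u X2) // !orbF.
  have [->|xv] := eqVneq x v; first by rewrite (out2 v X2) // !orbF.
  by rewrite !addbF.
apply: in_two_sum => //; move: fX.
rewrite !in_symdiff !inE eq_sym (negbTE uf) eq_sym (negbTE vf) /=.
by do 2 case: (f \in _).
Qed.

Lemma two_sum_even D1 D2 f :
  even_delta_matroid D1 -> even_delta_matroid D2 ->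
  ground D1 :&: ground D2 = [set f] ->
  (exists2 F, F \in feasible D2 & f \notin F) ->
  (exists2 F, F \in feasible D2 & f \in F) ->
  even_delta_matroid (two_sum D1 D2 f).
Proof.
move=> ev1 ev2 gf [G0 G0D fG0] [G1 G1D fG1].
have [[ne1 sub1 _] par1] := ev1; have [[_ sub2 _] par2] := ev2.
split; last first.
  (* The two parts are disjoint: only [f] could be shared, and it lies in just one of them. Removing
     [f] accounts for the negation. *)
  have odd2 X1 X2 : X1 \in feasible D1 -> X2 \in feasible D2 ->
      (f \in X1) (+) (f \in X2) -> odd #|(X1 :|: X2) :\ f| = ~~ odd #|X1| (+) odd #|X2|.
    move=> X1D X2D fX.
    have := cardsD1 f (X1 :|: X2); have -> : f \in X1 :|: X2.
      by rewrite inE; move: fX; case: (f \in X1) => //=.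
    rewrite cardsU (_ : X1 :&: X2 = set0) ?cards0 ?subn0; last first.
      apply/setP => x; rewrite !inE; apply/negP => /andP [x1 x2].
      move: (in_set1 x f); rewrite -gf inE (subsetP (sub1 _ X1D)) // (subsetP (sub2 _ X2D)) //=.
      by move/esym/eqP => xf; move: fX; rewrite -xf x1 x2.
    by move/(congr1 odd); rewrite !oddD /= addNb => ->; rewrite negbK.
  move=> X Y /two_sum_feasibleP [X1 [X2 [X1D X2D fX ->]]].
  move=> /two_sum_feasibleP [Y1 [Y2 [Y1D Y2D fY ->]]].
  by rewrite !odd2 // (par1 X1 Y1) // (par2 X2 Y2).
split.
- case/set0Pn: ne1 => F FD; apply/set0Pn.
  have [fF|fF] := boolP (f \in F).
    by exists ((F :|: G0) :\ f); apply: in_two_sum; rewrite // fF.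
  by exists ((F :|: G1) :\ f); apply: in_two_sum; rewrite // fG1 (negbTE fF).
- move=> F /two_sum_feasibleP [F1 [F2 [F1D F2D _ ->]]].
  by rewrite /= setSD // setUSS ?sub1 ?sub2.
move=> X Y u XD YD uXY.
have [u1|u1] := boolP (u \in ground D1); first exact: two_sum_exchange uXY u1.
have u2 : u \in ground D2.
  have [X1 [X2 [/sub1 /subsetP X1D /sub2 /subsetP X2D _ eX]]] := two_sum_feasibleP XD.
  have [Y1 [Y2 [/sub1 /subsetP Y1D /sub2 /subsetP Y2D _ eY]]] := two_sum_feasibleP YD.
  have : (u \in X) || (u \in Y) by move: uXY; rewrite in_symdiff; do 2 case: (u \in _).
  rewrite eX eY !inE; case/orP => [/andP [_ /orP [/X1D|/X2D]]|/andP [_ /orP [/Y1D|/Y2D]]] //.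
    by rewrite (negbTE u1).
  by rewrite (negbTE u1).
(* By symmetry of the two-sum, the remaining case is an exchange that starts in [D2]. *)
move: XD YD; rewrite two_sumC => XD YD.
by apply: two_sum_exchange uXY u2 => //; rewrite setIC.
Qed.

Lemma symdiff_sub X Y B : X \subset B -> Y \subset B -> symdiff X Y \subset B.
Proof.
by move=> sX sY; rewrite subUset !(subset_trans (subsetDl _ _)).
Qed.

Lemma card_symdiff_two_sum B1 B2 F1 F2 A1 A2 f :
  [disjoint B1 & B2] -> F1 :\ f \subset B1 -> F2 :\ f \subset B2 ->
  A1 \subset B1 -> A2 \subset B2 ->
  #|symdiff ((F1 :|: F2) :\ f) (A1 :|: A2)| =
  (#|symdiff (F1 :\ f) A1| + #|symdiff (F2 :\ f) A2|)%N.
Proof.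
move=> dis sF1 sF2 sA1 sA2.
have d1 : symdiff (F1 :\ f) A1 \subset B1.
  exact: symdiff_sub.
have d2 : symdiff (F2 :\ f) A2 \subset B2.
  exact: symdiff_sub.
have d : [disjoint symdiff (F1 :\ f) A1 & symdiff (F2 :\ f) A2].
  exact: disjointWl d1 (disjointWr d2 dis).
rewrite -(eqTleqif (leq_card_setU _ _) d); apply: eq_card => x.
rewrite in_setU !in_symdiff setDUl !in_setU.
have n1 X : X \subset B1 -> x \in X -> x \in B2 = false.
  by move=> s xX; apply: (disjointFr dis); apply: (subsetP s).
have n2 X : X \subset B2 -> x \in B2 = false -> x \in X = false.
  by move=> s xB; apply/negP => /(subsetP s); rewrite xB.
have [xB|xB] := boolP (x \in B2).
  have h X : X \subset B1 -> x \in X = false.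
    by move=> s; apply/negP => /(n1 _ s); rewrite xB.
  by rewrite (h (F1 :\ f)) // (h A1).
by rewrite (n2 (F2 :\ f)) ?(n2 A2) ?(negbTE xB) // !orbF.
Qed.

(** The status of [f] in [F1] decides whether [F2] costs at least [d0] or at least [d1]. These
    differ by exactly one, so the more expensive choice pays a penalty of one. This is the penalty
    that [f] itself adds to the distance from [F1] to [f |: A1] when [d0 < d1], and to [A1]
    otherwise. *)
Lemma dist_two_sum D1 D2 f A1 A2 :
  even_delta_matroid D1 -> even_delta_matroid D2 ->
  ground D1 :&: ground D2 = [set f] ->
  (exists2 F, F \in feasible D2 & f \notin F) ->
  (exists2 F, F \in feasible D2 & f \in F) ->
  A1 \subset ground D1 :\ f -> A2 \subset ground D2 :\ f ->
  let d0 := dist (plain_delete D2 f) A2 in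
  let d1 := dist (plain_contract D2 f) A2 in
  dist (two_sum D1 D2 f) (A1 :|: A2) =
    if (d0 < d1)%N then (d0 + dist D1 (f |: A1))%N else (d1 + dist D1 A1)%N.
Proof.
move=> ev1 ev2 gf e0 e1 sA1 sA2 /=.
set d0 := dist (plain_delete _ _) _; set d1 := dist (plain_contract _ _) _.
have fA1 : f \notin A1 by apply/negP => /(subsetP sA1); rewrite !inE eqxx.
have fA2 : f \notin A2 by apply/negP => /(subsetP sA2); rewrite !inE eqxx.
have [[ne1 sub1 _] _] := ev1; have [[_ sub2 _] _] := ev2.
have dis : [disjoint ground D1 :\ f & ground D2 :\ f].
  rewrite -setI_eq0; apply/eqP/setP => x; move/setP/(_ x): gf; rewrite !inE.
  by case: eqP.
have cE F1 F2 : F1 \in feasible D1 -> F2 \in feasible D2 ->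
    #|symdiff ((F1 :|: F2) :\ f) (A1 :|: A2)| =
    (#|symdiff (F1 :\ f) A1| + #|symdiff (F2 :\ f) A2|)%N.
  by move=> F1D F2D; apply: (card_symdiff_two_sum dis) => //;
    apply: setSD; [apply: sub1|apply: sub2].
have c2 F2 : f \notin F2 -> #|symdiff (F2 :\ f) A2| = #|symdiff F2 A2|.
  by move=> fF; rewrite (card_symdiff_notin F2 fA2) (negbTE fF) addn0.
have [G0 [G0D fG0 E0]] := dist_delete_attained A2 e0.
have [G1 [G1D fG1 E1]] := dist_contract_attained A2 e1.
have dd := dist_delete_contract ev2 e0 e1 fA2; rewrite /= -/d0 -/d1 in dd.
apply/eqP; rewrite eqn_leq; apply/andP; split.
  (* Upper bound: any [F1] is completed by the nearest feasible set of [D2] with the opposite status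
     at [f], namely [G0] or [G1]. *)
  have ub F1 : F1 \in feasible D1 ->
      (dist (two_sum D1 D2 f) (A1 :|: A2) <=
       #|symdiff (F1 :\ f) A1| + if f \in F1 then d0 else d1)%N.
    move=> F1D; case: ifP => fF1.
      by rewrite /d0 E0 -c2 // -cE //; apply/dist_le/in_two_sum; rewrite ?fF1.
    by rewrite /d1 E1 -cE //; apply/dist_le/in_two_sum; rewrite ?fF1.
  case: ifP => lt.
    have [F1 F1D eF1] := dist_attained (f |: A1) ne1.
    apply: leq_trans (ub _ F1D) _; rewrite eF1 (card_symdiff_setU1 _ fA1).
    by clearbody d0 d1; clear -dd lt; case: (f \in F1) => /=; lia.
  have [F1 F1D eF1] := dist_attained A1 ne1.
  apply: leq_trans (ub _ F1D) _; rewrite eF1 (card_symdiff_notin F1 fA1).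
  by clearbody d0 d1; clear -dd lt; case: (f \in F1) => /=; lia.
(* Lower bound: a nearest feasible set of the two-sum splits into [F1] and [F2], and the gap of one
   between [d0] and [d1] absorbs a status of [f] that does not match the cheaper side. *)
have [|F FD ->] := @dist_attained _ (two_sum D1 D2 f) (A1 :|: A2).
  by case: (two_sum_even ev1 ev2 gf e0 e1) => [[]].
have [F1 [F2 [F1D F2D fF ->]]] := two_sum_feasibleP FD.
have h1 := dist_le (f |: A1) F1D; have h2 := dist_le A1 F1D.
rewrite (card_symdiff_setU1 _ fA1) in h1; rewrite (card_symdiff_notin F1 fA1) in h2.
rewrite cE //; have [f1|f1] := boolP (f \in F1); rewrite ?(negbTE f1) ?f1 /= in fF h1 h2.
  have h3 := dist_delete_le A2 F2D fF; rewrite -/d0 -c2 // in h3.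
  clearbody d0 d1; clear -dd h1 h2 h3; case: ifP => /=; lia.
have h3 := dist_contract_le A2 F2D fF; rewrite -/d1 in h3.
clearbody d0 d1; clear -dd h1 h2 h3; case: ifP => /=; lia.
Qed.

End TwoSum.

(** * Sums over powersets and multiplicative weights *)

Section PowersetSums.
Variables (T : finType) (R : comNzRingType).
Implicit Types (A B C S : {set T}) (u v : T -> R).

Lemma sum_powersetU B C (F : {set T} -> R) : [disjoint B & C] ->
  \sum_(A in powerset (B :|: C)) F A =
  \sum_(A1 in powerset B) \sum_(A2 in powerset C) F (A1 :|: A2).
Proof.
move=> dis; rewrite pair_big /=.
rewrite (reindex_onto (fun p : {set T} * {set T} => p.1 :|: p.2)
                      (fun A => (A :&: B, A :&: C))) /=; last first.
  by move=> A; rewrite powersetE -setIUr => /setIidPl.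
apply: eq_bigl => -[A1 A2] /=; rewrite !powersetE xpair_eqE.
apply/idP/idP => [/and3P [_ /eqP <- /eqP <-]|/andP [s1 s2]].
  by rewrite !subsetIr.
rewrite setUSS //= !setIUl (setIidPl s1) (setIidPl s2).
have -> : A2 :&: B = set0.
  by apply/eqP; rewrite setI_eq0; apply: disjointWl s2 _; rewrite disjoint_sym.
have -> : A1 :&: C = set0 by apply/eqP; rewrite setI_eq0; apply: disjointWl s1 dis.
by rewrite setU0 set0U !eqxx.
Qed.

Definition weight S u v A : R := \prod_(g in S) (if g \in A then v g else u g).

Lemma weight_set1 f u v A : weight [set f] u v A = if f \in A then v f else u f.
Proof. exact: big_set1. Qed.

Lemma weightU B C u v A1 A2 : [disjoint B & C] -> A1 \subset B -> A2 \subset C ->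
  weight (B :|: C) u v (A1 :|: A2) = weight B u v A1 * weight C u v A2.
Proof.
move=> dis s1 s2; rewrite /weight.
rewrite (eq_bigl [predU B & C]); last by move=> g; rewrite !inE.
rewrite bigU //=; congr (_ * _); apply: eq_bigr => g gS; rewrite inE.
  suff -> : g \in A2 = false by rewrite orbF.
  by apply/negP => /(subsetP s2); rewrite (disjointFr dis gS).
suff -> : g \in A1 = false by [].
by apply/negP => /(subsetP s1); rewrite (disjointFl dis gS).
Qed.

Lemma eq_weight S u v u' v' A : {in S, u =1 u'} -> {in S, v =1 v'} ->
  weight S u v A = weight S u' v' A.
Proof. by move=> eu ev; apply: eq_bigr => g gS; rewrite eu ?ev. Qed.

Lemma weight_const S A (a b : R) : A \subset S ->
  weight S (fun=> a) (fun=> b) A = a ^+ #|S :\: A| * b ^+ #|A|.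
Proof.
move=> sA; rewrite /weight (bigID (mem A)) /= mulrC; congr (_ * _).
  rewrite -prodr_const; apply: eq_big => [g|g /andP [_ /negbTE ->] //].
  by rewrite inE andbC.
rewrite -prodr_const; apply: eq_big => [g|g /andP [_ ->] //].
by rewrite andbC andb_idr // => /(subsetP sA).
Qed.

End PowersetSums.

(** * The weighted transition polynomial under minors and two-sums *)

Section TransitionPolynomial.
Variables (T : finType) (R : comNzRingType) (t : R).
Implicit Types (D : set_system T) (u v : T -> R).

Definition transition D u v : R :=
  \sum_(A in powerset (ground D)) weight (ground D) u v A * t ^+ dist D A.

Definition delete_part D e u v : R :=
  \sum_(A in powerset (ground D :\ e)
          | (dist (plain_delete D e) A < dist (plain_contract D e) A)%N)
    weight (ground D :\ e) u v A * t ^+ dist (plain_delete D e) A.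

(** The test is the exact negation of the one in [delete_part], so the two index sets partition the
    powerset. For even [D] and non-singular [e] it says that the contraction is strictly nearer. *)
Definition contract_part D e u v : R :=
  \sum_(A in powerset (ground D :\ e)
          | ~~ (dist (plain_delete D e) A < dist (plain_contract D e) A)%N)
    weight (ground D :\ e) u v A * t ^+ dist (plain_contract D e) A.

Lemma eq_delete_part D e u v u' v' :
  {in ground D :\ e, u =1 u'} -> {in ground D :\ e, v =1 v'} ->
  delete_part D e u v = delete_part D e u' v'.
Proof. by move=> eu ev; apply: eq_bigr => A _; rewrite (eq_weight _ eu ev). Qed.

Lemma eq_contract_part D e u v u' v' :
  {in ground D :\ e, u =1 u'} -> {in ground D :\ e, v =1 v'} ->
  contract_part D e u v = contract_part D e u' v'.
Proof. by move=> eu ev; apply: eq_bigr => A _; rewrite (eq_weight _ eu ev). Qed.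

Lemma eq_transition D u v u' v' :
  {in ground D, u =1 u'} -> {in ground D, v =1 v'} ->
  transition D u v = transition D u' v'.
Proof. by move=> eu ev; apply: eq_bigr => A _; rewrite (eq_weight _ eu ev). Qed.

Section Minors.
Variables (D : set_system T) (e : T) (u v : T -> R).
Hypotheses (evD : even_delta_matroid D)
  (e0 : exists2 F, F \in feasible D & e \notin F)
  (e1 : exists2 F, F \in feasible D & e \in F).

(** On the sets counted by [contract_part] the deletion is farther by exactly one, which produces
    the factor [t]; [transition_contract] is the mirror image. *)
Lemma transition_delete : transition (plain_delete D e) u v =
  delete_part D e u v + t * contract_part D e u v.
Proof.
rewrite /transition /= (bigID (fun A =>
  (dist (plain_delete D e) A < dist (plain_contract D e) A)%N)) /=.
congr (_ + _); rewrite mulr_sumr; apply: eq_bigr => A /andP [sA lt].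
have eA : e \notin A.
  apply: contraL sA => eA; rewrite powersetE; apply/subsetP => /(_ _ eA).
  by rewrite !inE eqxx.
have := dist_delete_contract evD e0 e1 eA => /=; move: lt; rewrite -leqNgt.
by case/boolP: (_ == _) => [/eqP -> _ _|_ le /eqP h]; [rewrite exprS mulrCA | rewrite h ltnn in le].
Qed.

Lemma transition_contract : transition (plain_contract D e) u v =
  t * delete_part D e u v + contract_part D e u v.
Proof.
rewrite /transition /= (bigID (fun A =>
  (dist (plain_delete D e) A < dist (plain_contract D e) A)%N)) /=.
congr (_ + _); rewrite mulr_sumr; apply: eq_bigr => A /andP [sA lt].
have eA : e \notin A.
  apply: contraL sA => eA; rewrite powersetE; apply/subsetP => /(_ _ eA).
  by rewrite !inE eqxx.
move: lt; case/orP: (dist_delete_contract evD e0 e1 eA) => /eqP h; last by rewrite h exprS mulrCA.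
by rewrite h ltnNge leqnSn.
Qed.

End Minors.

(** Write [A] as [A1 :|: A2] and fix [A1]. By [dist_two_sum], the [A2] with the deletion nearer sum
    up to the term of [f |: A1] in [D1], and the other [A2] to the term of [A1]; the inner sums
    become the weights of [f]. *)
Lemma transition_two_sum D1 D2 f u v :
  even_delta_matroid D1 -> even_delta_matroid D2 ->
  ground D1 :&: ground D2 = [set f] ->
  (exists2 F, F \in feasible D2 & f \notin F) ->
  (exists2 F, F \in feasible D2 & f \in F) ->
  transition (two_sum D1 D2 f) u v =
  transition D1 (fun g => if g == f then contract_part D2 f u v else u g)
                (fun g => if g == f then delete_part D2 f u v else v g).
Proof.
move=> ev1 ev2 gf e0 e1.
have dis : [disjoint ground D1 :\ f & ground D2 :\ f].
  rewrite -setI_eq0; apply/eqP/setP => x; move/setP/(_ x): gf; rewrite !inE.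
  by case: eqP.
have f1 : f \in ground D1.
  by move/setP/(_ f): gf; rewrite !inE eqxx => /andP [].
rewrite /transition /= setDUl sum_powersetU //.
have d1 : [disjoint ground D1 :\ f & [set f]].
  by rewrite disjoint_sym disjoints1 !inE eqxx.
have e1' : ground D1 = ground D1 :\ f :|: [set f] by rewrite setUC setD1K.
rewrite [in RHS]e1' (sum_powersetU _ d1).
apply: eq_bigr => A1; rewrite powersetE => sA1.
have fA1 : f \notin A1 by apply/negP => /(subsetP sA1); rewrite !inE eqxx.
set u' := fun g => if g == f then contract_part D2 f u v else u g.
set v' := fun g => if g == f then delete_part D2 f u v else v g.
have eW : weight (ground D1 :\ f) u' v' A1 = weight (ground D1 :\ f) u v A1.
  by apply: eq_weight => g; rewrite !inE /u' /v' => /andP [/negbTE ->].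
(* The sum over subsets of [[set f]] has two terms, [set0] and [[set f]]. *)
rewrite powerset1 big_setU1 ?big_set1 ?inE /=; last first.
  by rewrite eq_sym; apply/set0Pn; exists f; rewrite inE.
rewrite !weightU ?sub0set // eW !weight_set1 !inE eqxx /u' /v' eqxx.
rewrite setU0 (setUC A1 [set f]).
rewrite (bigID (fun A => (dist (plain_delete D2 f) A < dist (plain_contract D2 f) A)%N)) /= addrC.
rewrite /delete_part /contract_part !mulr_sumr !mulr_suml; congr (_ + _).
  apply: eq_bigr => A2 /andP []; rewrite powersetE => sA2 lt.
  by rewrite weightU // (dist_two_sum ev1) // (negbTE lt) exprD !mulrA.
apply: eq_bigr => A2 /andP []; rewrite powersetE => sA2 lt.
by rewrite weightU // (dist_two_sum ev1) // lt exprD !mulrA.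
Qed.

(** Induction on the list of two-sums. The induction hypothesis leaves weights that are already
    altered on the tail of [s], which is why [transition_two_sum] is needed for element-dependent
    weights. *)
Lemma transition_foldl_two_sum (Df : T -> set_system T) (a b : R) s D :
  even_delta_matroid D -> uniq s -> {subset s <= ground D} ->
  {in s, forall f, [/\ even_delta_matroid (Df f),
     ground D :&: ground (Df f) = [set f],
     (exists2 F, F \in feasible (Df f) & f \notin F) &
     (exists2 F, F \in feasible (Df f) & f \in F)]} ->
  {in s &, forall f g, f != g -> [disjoint ground (Df f) & ground (Df g)]} ->
  even_delta_matroid (foldl (fun D' f => two_sum D' (Df f) f) D s) /\
  transition (foldl (fun D' f => two_sum D' (Df f) f) D s) (fun=> a) (fun=> b) =
  transition D
    (fun g => if g \in s then contract_part (Df g) g (fun=> a) (fun=> b) else a)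
    (fun g => if g \in s then delete_part (Df g) g (fun=> a) (fun=> b) else b).
Proof.
elim: s D => [|f s IH] D evD //= /andP [fs us] sD hs dis.
have [evf gf f0 f1] := hs f (mem_head _ _).
have [||g gs|g gs|g h gs hs'|evF ->] := IH (two_sum D (Df f) f).
- exact: two_sum_even.
- by [].
- have gf' : g != f by apply: contraNneq fs => <-.
  by rewrite !inE gf' sD // inE gs orbT.
- have gf' : g != f by apply: contraNneq fs => <-.
  have [|evg gg g0 g1] := hs g; first by rewrite inE gs orbT.
  (* The copy at [g] is disjoint from the copy at [f], so it still meets the enlarged ground set in
     [g] alone. *)
  have := dis f g; rewrite !inE eqxx gs orbT eq_sym gf' => /(_ isT isT isT) dfg.
  split=> //; apply/setP => x; move/setP/(_ x): gg; rewrite !inE.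
  have [xg|xg] := boolP (x \in ground (Df g)); last by rewrite !andbF.
  rewrite (disjointFl dfg xg) orbF !andbT => ->.
  by case: eqP => [->|]; rewrite ?(eq_sym f) // ?(negbTE gf') andbF.
- by apply: dis; rewrite inE ?gs ?hs' orbT.
split=> //; rewrite transition_two_sum //.
(* The copy at [f] meets [ground D], and hence [s], only in [f]; its other elements therefore still
   carry the constant weights [a] and [b]. *)
have out g : g \in ground (Df f) :\ f -> g \in s = false.
  rewrite !inE => /andP [gf' gD]; apply/negP => gs; move: gf'.
  have gD' : g \in ground D by rewrite sD // inE gs orbT.
  by rewrite -in_set1 -gf inE gD' gD.
apply: eq_transition => g _; rewrite inE; case: eqP => // ->.
  by apply: eq_contract_part => x /out ->.
by apply: eq_delete_part => x /out ->.
Qed.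

End TransitionPolynomial.

(** * Invariance under isomorphism *)

Section Isomorphism.
Variables (T U : finType).
Implicit Types (D : set_system T) (E : set_system U) (phi : T -> U).

Lemma mem_imset_in phi (S A : {set T}) x : {in S &, injective phi} ->
  A \subset S -> x \in S -> (phi x \in phi @: A) = (x \in A).
Proof.
move=> inj sA xS; apply/imsetP/idP => [[y yA /inj e]|]; last by exists x.
by rewrite e // (subsetP sA).
Qed.

Lemma imset_symdiff phi (S A B : {set T}) : {in S &, injective phi} ->
  A \subset S -> B \subset S ->
  symdiff (phi @: A) (phi @: B) = phi @: symdiff A B.
Proof.
move=> inj sA sB; have sAB := symdiff_sub sA sB.
apply/setP => y; have [/imsetP [x xS ->]|yS] := boolP (y \in phi @: S).
  by rewrite in_symdiff !(mem_imset_in inj) // in_symdiff.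
have out (X : {set T}) : X \subset S -> y \in phi @: X = false.
  by move=> sX; apply: contraNF yS => yX; apply: (subsetP (imsetS phi sX)).
by rewrite in_symdiff !out.
Qed.

Lemma isomorphism_feasible D E phi F' :
  (forall F, F \in feasible E -> F \subset ground E) ->
  dm_isomorphism D E phi -> F' \in feasible E ->
  exists2 F, F \in feasible D & F' = phi @: F.
Proof.
move=> sub' [inj img fe] F'D.
(* The preimage is cut down to [ground D], because [phi] is controlled only there. *)
have e : phi @: (ground D :&: phi @^-1: F') = F'.
  apply/setP => y; apply/imsetP/idP => [[x]|yF].
    by rewrite !inE => /andP [_ h] ->.
  have := subsetP (sub' _ F'D) y yF; rewrite -img => /imsetP [x xD xy].
  by exists x; rewrite // !inE xD -xy.
by exists (ground D :&: phi @^-1: F'); rewrite // fe ?subsetIl // e.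
Qed.

Lemma isomorphism_dist D E phi (A : {set T}) :
  feasible D != set0 -> (forall F, F \in feasible D -> F \subset ground D) ->
  (forall F, F \in feasible E -> F \subset ground E) ->
  dm_isomorphism D E phi -> A \subset ground D ->
  dist E (phi @: A) = dist D A.
Proof.
move=> ne sub sub' iso sA; have [inj img fe] := iso.
have c F : F \in feasible D -> #|symdiff (phi @: F) (phi @: A)| = #|symdiff F A|.
  move=> FD; rewrite (imset_symdiff inj (sub _ FD) sA).
  exact: card_in_imset (sub_in2 (subsetP (symdiff_sub (sub _ FD) sA)) inj).
have [F FD eF] := dist_attained A ne.
rewrite eF -c //; apply: dist_eq => [|G' /(isomorphism_feasible sub' iso) [G GD ->]].
  by rewrite -fe ?sub.
by rewrite !c // -eF; apply: dist_le.
Qed.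

Lemma imsetD1_in phi (S A : {set T}) x : {in S &, injective phi} ->
  A \subset S -> x \in S -> phi @: (A :\ x) = (phi @: A) :\ phi x.
Proof.
move=> inj sA xS; apply/setP => y; rewrite !inE.
apply/imsetP/andP => [[z]|[yx /imsetP [z zA yz]]].
  rewrite !inE => /andP [zx zA] ->; split; last exact: imset_f.
  by apply: contraNneq zx => /inj -> //; apply: (subsetP sA).
by exists z => //; rewrite !inE zA andbT; apply: contraNneq yx => <-; rewrite yz.
Qed.

Lemma isomorphism_even D E phi :
  delta_matroid D -> even_delta_matroid E -> dm_isomorphism D E phi ->
  even_delta_matroid D.
Proof.
move=> dmD [_ ev'] [inj img fe]; split=> // X Y XD YD.
have [_ sub _] := dmD.
have c F : F \in feasible D -> #|phi @: F| = #|F|.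
  by move=> FD; apply: card_in_imset (sub_in2 (subsetP (sub _ FD)) inj).
by rewrite -c // -(c Y) //; apply: ev'; rewrite -fe ?sub.
Qed.

Lemma isomorphism_delete D E phi e : e \in ground D ->
  (forall F, F \in feasible D -> F \subset ground D) ->
  dm_isomorphism D E phi ->
  dm_isomorphism (plain_delete D e) (plain_delete E (phi e)) phi.
Proof.
move=> eD sub [inj img fe]; split=> /=.
- by move=> x y; rewrite !inE => /andP [_ ?] /andP [_ ?]; apply: inj.
- by rewrite (imsetD1_in inj) // img.
move=> F; rewrite subsetD1 => /andP [sF eF].
by rewrite !inE -fe // (mem_imset_in inj).
Qed.

Lemma isomorphism_contract D E phi e : e \in ground D ->
  (forall F, F \in feasible D -> F \subset ground D) ->
  (forall F, F \in feasible E -> F \subset ground E) ->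
  dm_isomorphism D E phi ->
  dm_isomorphism (plain_contract D e) (plain_contract E (phi e)) phi.
Proof.
move=> eD sub sub' iso; have [inj img fe] := iso; split=> /=.
- by move=> x y; rewrite !inE => /andP [_ ?] /andP [_ ?]; apply: inj.
- by rewrite (imsetD1_in inj) // img.
move=> F sF; apply/imsetP/imsetP => [[G]|[G']]; rewrite inE => /andP [GD eG] eF.
  exists (phi @: G); last by rewrite eF (imsetD1_in inj) ?sub.
  by rewrite inE -fe ?sub // GD imset_f.
have [G {}GD eG'] := isomorphism_feasible sub' iso GD.
exists G; first by rewrite inE GD -(mem_imset_in inj (sub _ GD) eD) -eG'.
have sF' : F \subset ground D by apply: subset_trans sF (subsetDl _ _).
apply/setP => x; have [xD|xD] := boolP (x \in ground D); last first.
  by rewrite !inE (contraNF (subsetP (sub _ GD) x)) // andbF (contraNF (subsetP sF' x)).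
rewrite -(mem_imset_in inj sF' xD) eF eG' -(imsetD1_in inj (sub _ GD) eD).
by rewrite (mem_imset_in inj) // (subset_trans (subsetDl _ _)) ?sub.
Qed.

Lemma sum_powerset_imset (R : nmodType) phi (S : {set T}) (F : {set U} -> R)
    (P : pred {set U}) : {in S &, injective phi} ->
  \sum_(A in powerset (phi @: S) | P A) F A =
  \sum_(A in powerset S | P (phi @: A)) F (phi @: A).
Proof.
move=> inj.
rewrite (reindex_onto (fun A : {set T} => phi @: A) (fun A' => S :&: phi @^-1: A')) /=; last first.
  move=> A' /andP []; rewrite powersetE => /subsetP sA _.
  apply/setP => y; apply/imsetP/idP => [[x]|yA].
    by rewrite !inE => /andP [_ h] ->.
  by have /imsetP [x xS xy] := sA _ yA; exists x; rewrite // !inE xS -xy.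
apply: eq_bigl => A; rewrite !powersetE.
apply/idP/idP => [/andP [/andP [_ ->] /eqP <-]|/andP [sA ->]].
  by rewrite subsetIl.
rewrite imsetS // andbT /=; apply/eqP/setP => x; rewrite !inE.
have [xS|xS] := boolP (x \in S); first by rewrite (mem_imset_in inj).
by rewrite (contraNF (subsetP sA x)).
Qed.

(** With constant weights both parts depend only on cardinalities and on distances in the two
    minors, all of which an isomorphism preserves. *)
Lemma isomorphism_parts (R : comNzRingType) (t a b : R) D E phi e :
  e \in ground D -> even_delta_matroid D -> even_delta_matroid E ->
  (exists2 F, F \in feasible D & e \notin F) ->
  (exists2 F, F \in feasible D & e \in F) ->
  dm_isomorphism D E phi ->
  delete_part t D e (fun=> a) (fun=> b) = delete_part t E (phi e) (fun=> a) (fun=> b) /\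
  contract_part t D e (fun=> a) (fun=> b) = contract_part t E (phi e) (fun=> a) (fun=> b).
Proof.
move=> eD evD evD' e0 e1 iso; have [inj img fe] := iso.
have [[_ sub _] _] := evD; have [[_ sub' _] _] := evD'.
have isod := isomorphism_delete eD sub iso.
have isoc := isomorphism_contract eD sub sub' iso.
have sd' F : F \in feasible (plain_delete E (phi e)) ->
    F \subset ground (plain_delete E (phi e)).
  by rewrite inE => /andP [FD eF]; rewrite /= subsetD1 sub'.
have sc' F : F \in feasible (plain_contract E (phi e)) ->
    F \subset ground (plain_contract E (phi e)).
  by case/imsetP => G; rewrite inE => /andP [GD _] ->; apply: setSD; apply: sub'.
have [[ned sd _] _] := plain_delete_even evD e0.
have [[nec sc _] _] := plain_contract_even evD e1.
have [injd imgd _] := isod; rewrite /= in injd imgd.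
have dd (A : {set T}) : A \subset ground D :\ e ->
    dist (plain_delete E (phi e)) (phi @: A) = dist (plain_delete D e) A.
  by move=> sA; apply: isomorphism_dist isod _.
have dc (A : {set T}) : A \subset ground D :\ e ->
    dist (plain_contract E (phi e)) (phi @: A) = dist (plain_contract D e) A.
  by move=> sA; apply: isomorphism_dist isoc _.
have wc (A : {set T}) : A \subset ground D :\ e ->
    weight (ground E :\ phi e) (fun=> a) (fun=> b) (phi @: A) =
    weight (ground D :\ e) (fun=> a) (fun=> b) A.
  move=> sA; have sA' : phi @: A \subset ground E :\ phi e by rewrite -imgd imsetS.
  have cA : #|phi @: A| = #|A| by apply: card_in_imset (sub_in2 (subsetP sA) injd).
  rewrite !weight_const // cA; congr (_ ^+ _ * _).
  by rewrite (cardsDS sA) (cardsDS sA') cA -imgd card_in_imset.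
split.
  rewrite /delete_part -imgd sum_powerset_imset //; apply: eq_big => [A|A].
    by rewrite powersetE; case: (boolP (A \subset _)) => //= sA; rewrite dd // dc.
  by rewrite powersetE => /andP [sA _]; rewrite imgd wc // dd.
rewrite /contract_part -imgd sum_powerset_imset //; apply: eq_big => [A|A].
  by rewrite powersetE; case: (boolP (A \subset _)) => //= sA; rewrite dd // dc.
by rewrite powersetE => /andP [sA _]; rewrite imgd wc // dc.
Qed.

End Isomorphism.

Lemma nonsingularP (T : finType) (D : set_system T) e : nonsingular D e ->
  [/\ e \in ground D, ~~ coloop D e, ~~ loop D e,
      (exists2 F, F \in feasible D & e \notin F)
    & (exists2 F, F \in feasible D & e \in F)].
Proof.
case/andP => eD; rewrite /singular eD /= => /norP [nc /norP [nl _]].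
split=> //.
  by move: nc; rewrite /coloop eD /= => /forall_inPn [F]; exists F.
by move: nl; rewrite /loop eD /= => /forall_inPn [F FD]; rewrite negbK; exists F.
Qed.

(** * Scaling, ring morphisms, non-vanishing, and the Tutte polynomial as a transition polynomial *)

Section Evaluation.
Variable T : finType.
Implicit Types (D : set_system T).

Lemma transition_scale (R : comNzRingType) (t c a b : R) D :
  transition t D (fun=> c * a) (fun=> c * b) =
  c ^+ #|ground D| * transition t D (fun=> a) (fun=> b).
Proof.
rewrite mulr_sumr; apply: eq_bigr => A _; rewrite mulrA; congr (_ * _).
rewrite -prodr_const -big_split; apply: eq_bigr => g _.
by case: (g \in A).
Qed.

Lemma rmorph_weight (R S : comNzRingType) (h : {rmorphism R -> S}) (a b : R)
    (B A : {set T}) :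
  h (weight B (fun=> a) (fun=> b) A) = weight B (fun=> h a) (fun=> h b) A.
Proof. by rewrite rmorph_prod; apply: eq_bigr => g _; case: ifP. Qed.

(** Serves both for the embedding into the fraction field and for the evaluation of the variables at
    1. *)
Lemma rmorph_delete_part (R S : comNzRingType) (h : {rmorphism R -> S})
    (t a b : R) D e :
  h (delete_part t D e (fun=> a) (fun=> b)) =
  delete_part (h t) D e (fun=> h a) (fun=> h b).
Proof.
by rewrite rmorph_sum; apply: eq_bigr => A _; rewrite rmorphM rmorphXn rmorph_weight.
Qed.

Lemma rmorph_contract_part (R S : comNzRingType) (h : {rmorphism R -> S})
    (t a b : R) D e :
  h (contract_part t D e (fun=> a) (fun=> b)) =
  contract_part (h t) D e (fun=> h a) (fun=> h b).
Proof.
by rewrite rmorph_sum; apply: eq_bigr => A _; rewrite rmorphM rmorphXn rmorph_weight.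
Qed.

Lemma weight1 (R : comNzRingType) (B A : {set T}) :
  weight B (fun=> 1) (fun=> 1) A = 1 :> R.
Proof. by apply: big1 => g _; rewrite if_same. Qed.

(** With all parameters equal to 1 the sum counts its index sets. A feasible [F] avoiding [e] is one
    of them: it has distance 0 in the deletion, hence distance 1 in the contraction. *)
Lemma delete_part1_neq0 D e : even_delta_matroid D ->
  (exists2 F, F \in feasible D & e \notin F) ->
  (exists2 F, F \in feasible D & e \in F) ->
  delete_part 1 D e (fun=> 1) (fun=> 1) != 0 :> int.
Proof.
move=> evD e0 e1; have [F FD eF] := e0; have [[_ sub _] _] := evD.
rewrite /delete_part (eq_bigr (fun=> 1)); last by move=> A _; rewrite weight1 expr1n mulr1.
rewrite big_const_seq; set c := count _ _.
have -> : iter c (+%R 1) 0 = c%:Z by elim: c => //= n ->; rewrite -add1n PoszD.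
rewrite eqz_nat -lt0n -has_count; apply/hasP; exists F; first by rewrite mem_index_enum.
rewrite powersetE subsetD1 sub //= eF /=.
have := dist_delete_contract evD e0 e1 eF => /=.
have /eqP -> : dist (plain_delete D e) F == 0%N.
  by rewrite -leqn0 (leq_trans (dist_delete_le F FD eF)) // /symdiff setDv setU0 cards0.
by move=> /eqP ->.
Qed.

Lemma contract_part1_neq0 D e : even_delta_matroid D ->
  (exists2 F, F \in feasible D & e \notin F) ->
  (exists2 F, F \in feasible D & e \in F) ->
  contract_part 1 D e (fun=> 1) (fun=> 1) != 0 :> int.
Proof.
move=> evD e0 e1; have [F FD eF] := e1; have [[_ sub _] _] := evD.
rewrite /contract_part (eq_bigr (fun=> 1)); last by move=> A _; rewrite weight1 expr1n mulr1.
rewrite big_const_seq; set c := count _ _.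
have -> : iter c (+%R 1) 0 = c%:Z by elim: c => //= n ->; rewrite -add1n PoszD.
(* The witness [F :\ e] is feasible in the contraction, so its distance there is 0 and the strict
   inequality fails. *)
rewrite eqz_nat -lt0n -has_count; apply/hasP; exists (F :\ e); first by rewrite mem_index_enum.
rewrite powersetE setSD ?sub //= -leqNgt.
have /eqP -> // : dist (plain_contract D e) (F :\ e) == 0%N.
by rewrite -leqn0 (leq_trans (dist_contract_le _ FD eF)) // /symdiff setDv setU0 cards0.
Qed.

(** Here [s] is a square root of [X * Y], so [(X * Y) ^+ sigma_on D A] is [s] to the power
    [2 sigma(A) = |A| - d(A) + d(set0)]; substituting this in each term isolates [s ^+ dist D A]. *)
Lemma tutte_transition (K : fieldType) (X Y s : K) D : even_delta_matroid D ->
  X != 0 -> Y != 0 -> s ^+ 2 = X * Y ->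
  tutte D (X + 1) (Y + 1) =
  X ^+ sigma D * s ^- dist D set0 * transition s D (fun=> 1) (fun=> Y / s).
Proof.
move=> evD X0 Y0 sXY.
have s0 : s != 0.
  by apply: contraTneq (mulf_neq0 X0 Y0) => s0; rewrite -sXY s0 expr0n eqxx.
rewrite /tutte /transition mulr_sumr; apply: eq_bigr => A; rewrite powersetE => sA.
rewrite weight_const // expr1n mul1r !addrK.
rewrite !expfzDr // -!exprnP.
have h : s ^+ (sigma_on D A).*2 * s ^+ dist D A = s ^+ #|A| * s ^+ dist D set0.
  by rewrite -!exprD (double_sigma_on evD sA).
have h2 : s ^+ (sigma_on D A).*2 = X ^+ sigma_on D A * Y ^+ sigma_on D A.
  by rewrite -mul2n exprM sXY exprMn.
rewrite h2 in h; rewrite -!exprnN expr_div_n.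
have Xn := expf_neq0 (sigma_on D A) X0; have Yn := expf_neq0 (sigma_on D A) Y0.
have sn := expf_neq0 (dist D set0) s0; have sm := expf_neq0 #|A| s0.
(* Denominators are cleared and all powers abstracted to atoms, leaving a rational identity that
   follows from [h]. *)
apply: (mulfI Xn); apply: (mulfI Yn); apply: (mulfI sn); apply: (mulfI sm).
move: (X ^+ sigma_on D A) (Y ^+ sigma_on D A) (s ^+ dist D set0) (s ^+ #|A|)
  (s ^+ dist D A) (X ^+ sigma D) (Y ^+ #|A|) Xn Yn sn sm h => x y c m d g k.
move=> {}X0 {}Y0 c0 m0 h; transitivity (g * k * (m * c)); first by field; rewrite X0 Y0.
by rewrite -h; field; rewrite c0 m0.
Qed.

Lemma sigma_rank D : even_delta_matroid D ->
  (2 * sigma D = rank (dm_min D) + rank (dm_max D))%N.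
Proof.
move=> evD; have [[ne sub _] _] := evD; rewrite mul2n.
by have := double_sigma evD; have := rank_max ne sub; rewrite rank_min //; lia.
Qed.

End Evaluation.

(** * Solving for p and q, and the tensor product identity over a field *)

Section Field.
Variables (K : fieldType) (a b : K).
Hypotheses (a0 : a != 0) (b0 : b != 0).

Let ab0 : a * b != 0. Proof. exact: mulf_neq0. Qed.

(** Take [s = a * b]; the weights [1] and [b / a] become [a] and [b] after rescaling, at the price
    of [a] to the power [- #|ground D|]. *)
Lemma tutte_sqr (T : finType) (D : set_system T) : even_delta_matroid D ->
  tutte D (a ^+ 2 + 1) (b ^+ 2 + 1) =
  a ^ ((2 * sigma D)%:Z - #|ground D|%:Z) * (a * b) ^ (- (rank (dm_min D))%:Z) *
    transition (a * b) D (fun=> a) (fun=> b).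
Proof.
move=> evD; have [[ne _ _] _] := evD.
rewrite (@tutte_transition _ _ _ _ (a * b)) ?expf_neq0 //; last by rewrite exprMn.
have -> : b ^+ 2 / (a * b) = a^-1 * b by field; rewrite a0 b0.
have := transition_scale (a * b) a^-1 a b D; rewrite mulVf // => ->.
rewrite rank_min // -exprnN expfzDr // -exprnN -exprnP exprM exprVn.
by rewrite !mulrA; congr (_ * _); rewrite mulrAC.
Qed.

(** The system in [p], [q] has determinant [t ^+ 2 - 1]; eliminating [q] leaves a multiple of [p] by
    [1 - t ^+ 2]. *)
Lemma linear_system_eq (t p q p' q' : K) : t ^+ 2 != 1 ->
  p * t + q = p' * t + q' -> p + q * t = p' + q' * t -> p = p' /\ q = q'.
Proof.
move=> t1 h1 h2.
have t1' : 1 - t ^+ 2 != 0 by rewrite subr_eq0 eq_sym.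
have e q1 p1 : (p1 + q1 * t) - t * (p1 * t + q1) = p1 * (1 - t ^+ 2) by ring.
have ep : p = p' by apply: (mulIf t1'); rewrite -(e q) -(e q') h1 h2.
by split=> //; move: h1; rewrite ep => /addrI.
Qed.

(** As [2 sigma = r_min + r_max], the powers of [a] with exponent [r_min] cancel. The number [n] is
    the size of the ground set before the minor is taken, whence the [+ 1]. *)
Lemma tutte_sqr_prefactor (T : finType) (D : set_system T) (n : nat) :
  even_delta_matroid D -> n = #|ground D|.+1 ->
  a ^ ((2 * sigma D)%:Z - #|ground D|%:Z) * (a * b) ^ (- (rank (dm_min D))%:Z) =
  a ^ ((rank (dm_max D))%:Z - n%:Z + 1) * b ^ (- (rank (dm_min D))%:Z).
Proof.
move=> evD ->; rewrite sigma_rank // expfzMl mulrA -expfzDr //.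
by congr (a ^ _ * _); rewrite PoszD -addn1 PoszD; ring.
Qed.

(** Once the nonzero monomials are cancelled, the equations compare two values of the same
    invertible linear map, one at [p], [q] and one at the two parts. *)
Lemma minor_equationsP (U : finType) (D2 : set_system U) (e : U) (p q : K) :
  (a * b) ^+ 2 != 1 -> even_delta_matroid D2 -> nonsingular D2 e ->
  (tutte (contract D2 e) (a ^+ 2 + 1) (b ^+ 2 + 1) =
     a ^ ((rank (dm_max (contract D2 e)))%:Z - #|ground D2|%:Z + 1) *
     b ^ (- (rank (dm_min (contract D2 e)))%:Z) * (p * (a * b) + q) /\
   tutte (delete D2 e) (a ^+ 2 + 1) (b ^+ 2 + 1) =
     a ^ ((rank (dm_max (delete D2 e)))%:Z - #|ground D2|%:Z + 1) *
     b ^ (- (rank (dm_min (delete D2 e)))%:Z) * (p + q * (a * b))) <->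
  p = delete_part (a * b) D2 e (fun=> a) (fun=> b) /\
  q = contract_part (a * b) D2 e (fun=> a) (fun=> b).
Proof.
move=> ab1 even2 nonsing2; have [eD ncoloop nloop e0 e1] := nonsingularP nonsing2.
have evd := plain_delete_even even2 e0; have evc := plain_contract_even even2 e1.
rewrite /contract /delete (negbTE ncoloop) (negbTE nloop) !tutte_sqr //.
have cE M : ground M = ground D2 :\ e -> #|ground D2| = #|ground M|.+1.
  by move=> ->; rewrite (cardsD1 e) eD.
rewrite !(tutte_sqr_prefactor _ (cE _ _)) //.
rewrite transition_contract // transition_delete //.
set p0 := delete_part _ _ _ _ _; set q0 := contract_part _ _ _ _ _.
have nz m n : a ^ m * b ^ n != 0 by rewrite mulf_neq0 ?expfz_neq0.
rewrite (mulrC _ p0) (mulrC _ q0); split=> [[]|[-> ->] //].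
move=> /(mulfI (nz _ _)) h1 /(mulfI (nz _ _)) h2.
by apply: (linear_system_eq ab1).
Qed.

(** Both sides reduce to the transition polynomial of [D1] with constant weights [q] and [p]: the
    left one through the two-sums, the right one through [tutte_transition] and a rescaling. *)
Lemma tutte_tensor (T U : finType) (D1 : set_system T) (D2 : set_system U)
    (e : U) (D : set_system T) (p q : K) :
  even_delta_matroid D1 -> even_delta_matroid D2 -> nonsingular D2 e ->
  is_tensor_product D1 D2 e D ->
  p = delete_part (a * b) D2 e (fun=> a) (fun=> b) ->
  q = contract_part (a * b) D2 e (fun=> a) (fun=> b) ->
  p != 0 -> q != 0 ->
  tutte D (a ^+ 2 + 1) (b ^+ 2 + 1) =
    q ^+ #|ground D1| * (p / (q * (a * b))) ^+ sigma D1 *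
    a ^ ((2 * sigma D)%:Z - #|ground D|%:Z) *
    (a * b) ^ ((rank (dm_min D1))%:Z - (rank (dm_min D))%:Z) *
    tutte D1 (q * (a * b) / p + 1) (p * (a * b) / q + 1).
Proof.
move=> even1 even2 nonsing2 tensorD pE qE p0 q0.
have [_ _ _ e0 e1] := nonsingularP nonsing2.
have [Df [s [copies dis perm_s defD]]] := tensorD.
have mem_s f : (f \in s) = (f \in ground D1) by rewrite (perm_mem perm_s) mem_enum.
(* Each copy inherits from [D2], through its isomorphism, evenness, non-singularity at [f] and the
   values [p] and [q]. *)
have copyP f : f \in ground D1 -> [/\ even_delta_matroid (Df f),
    (exists2 F, F \in feasible (Df f) & f \notin F),
    (exists2 F, F \in feasible (Df f) & f \in F) &
    delete_part (a * b) (Df f) f (fun=> a) (fun=> b) = p /\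
    contract_part (a * b) (Df f) f (fun=> a) (fun=> b) = q].
  move=> f1; have [dmf gf [phi iso phif]] := copies f f1.
  have ff : f \in ground (Df f) by move/setP/(_ f): gf; rewrite !inE eqxx => /andP [].
  have evf := isomorphism_even dmf even2 iso.
  have [[_ sub2 _] _] := even2; have [_ subf _] := dmf; have [inj _ _] := iso.
  have f0 : exists2 F, F \in feasible (Df f) & f \notin F.
    have [F' F'D eF'] := e0; have [F FD FF'] := isomorphism_feasible sub2 iso F'D.
    by exists F; rewrite // -(mem_imset_in inj (subf _ FD) ff) -FF' phif.
  have f1' : exists2 F, F \in feasible (Df f) & f \in F.
    have [F' F'D eF'] := e1; have [F FD FF'] := isomorphism_feasible sub2 iso F'D.
    by exists F; rewrite // -(mem_imset_in inj (subf _ FD) ff) -FF' phif.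
  split=> //; rewrite pE qE -phif.
  exact: isomorphism_parts ff evf even2 f0 f1' iso.
have [||f|f g|evD trD] := @transition_foldl_two_sum _ _ (a * b) Df a b s D1 even1.
- by rewrite (perm_uniq perm_s) enum_uniq.
- by move=> f; rewrite mem_s.
- rewrite mem_s => f1; have [evf f0 f1' _] := copyP f f1.
  by have [_ gf _] := copies f f1.
- by rewrite !mem_s; apply: dis.
rewrite -defD in evD trD.
have [[ne1 _ _] _] := even1.
rewrite tutte_sqr // trD.
rewrite (@eq_transition _ _ _ _ _ _ (fun=> q) (fun=> p)); first last.
- by move=> f f1; rewrite mem_s f1; have [_ _ _ []] := copyP f f1.
- by move=> f f1; rewrite mem_s f1; have [_ _ _ []] := copyP f f1.
(* The arguments [q (a b) / p] and [p (a b) / q] have product [(a b) ^+ 2], so the same root [a * b]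
   serves for [D1] as for [D]. *)
rewrite (@tutte_transition _ _ _ _ (a * b)) ?mulf_neq0 ?invr_eq0 //; last first.
  by field; rewrite p0 q0.
have -> : p * (a * b) / q / (a * b) = q^-1 * p by field; rewrite a0 b0 q0.
have := transition_scale (a * b) q^-1 q p D1; rewrite mulVf // => ->.
rewrite (rank_min ne1) (expfzDr (dist D1 set0)%:Z _ ab0) -exprnP exprVn.
have -> : q * (a * b) / p = (p / (q * (a * b)))^-1 by rewrite invf_div.
rewrite exprVn.
have qn := expf_neq0 #|ground D1| q0.
have rn : (p / (q * (a * b))) ^+ sigma D1 != 0.
  by rewrite expf_neq0 // mulf_neq0 ?invr_eq0 ?mulf_neq0.
have sn := expf_neq0 (dist D1 set0) ab0.
move: (q ^+ _) (_ ^+ sigma D1) ((a * b) ^+ _) (transition _ _ _ _) (a ^ _)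
  ((a * b) ^ _) qn rn sn => x y z w g k x0 y0 z0.
by field; rewrite x0 y0 z0.
Qed.

End Field.

(** * The identity in the fraction field, with p and q in the polynomial ring *)

Theorem theorem28 (T U : finType) (D1 : set_system T) (D2 : set_system U)
    (e : U) (D : set_system T)
    (even1 : even_delta_matroid D1)
    (nonsing1 : forall f, f \in ground D1 -> ~~ singular D1 f)
    (even2 : even_delta_matroid D2)
    (nonsing2 : nonsingular D2 e)
    (tensorD : is_tensor_product D1 D2 e D) :
  (exists! pq : Zxy * Zxy, pq_equations D2 e pq.1 pq.2) /\
  forall p q : Zxy, pq_equations D2 e p q ->
    [/\ p != 0, q != 0
      & tutte1 D =
          emb q ^+ #|ground D1| *
          (emb p / (emb q * sqxy)) ^+ sigma D1 *
          sqx ^ ((2 * sigma D)%:Z - #|ground D|%:Z) *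
          sqxy ^ ((rank (dm_min D1))%:Z - (rank (dm_min D))%:Z) *
          tutte D1 (emb q * sqxy / emb p + 1) (emb p * sqxy / emb q + 1)].
Proof.
have x0 : sqx != 0 by rewrite tofrac_eq0 -msize_poly_eq0 msizeX.
have y0 : sqy != 0 by rewrite tofrac_eq0 -msize_poly_eq0 msizeX.
pose t : Zxy := 'X_0 * 'X_1.
have embt : emb t = sqx * sqy by exact: tofracM.
have xy1 : (sqx * sqy) ^+ 2 != 1.
  rewrite -embt /emb -tofracXn -tofrac1 tofrac_eq.
  (* Evaluation of both variables at 0 separates the two sides. *)
  apply/eqP => /(congr1 (meval (fun=> 0))).
  by rewrite rmorphXn rmorphM rmorph1 /= !mevalXU mul0r expr0n.
have [_ _ _ e0 e1] := nonsingularP nonsing2.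
(* The solutions are built in the polynomial ring itself and only then embedded, which gives
   existence in Z[sqrt x, sqrt y]. *)
pose p0 : Zxy := delete_part t D2 e (fun=> 'X_0) (fun=> 'X_1).
pose q0 : Zxy := contract_part t D2 e (fun=> 'X_0) (fun=> 'X_1).
have embp : emb p0 = delete_part (sqx * sqy) D2 e (fun=> sqx) (fun=> sqy).
  by rewrite -embt; exact: (rmorph_delete_part (@tofrac _)).
have embq : emb q0 = contract_part (sqx * sqy) D2 e (fun=> sqx) (fun=> sqy).
  by rewrite -embt; exact: (rmorph_contract_part (@tofrac _)).
have meval1 : meval (fun=> 1 : int) t = 1 by rewrite rmorphM /= !mevalXU mulr1.
(* Evaluating both variables at 1 turns [p0] into a nonzero count of sets; the same works for
   [q0]. *)
have p0_neq0 : p0 != 0.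
  apply: contraNneq (delete_part1_neq0 even2 e0 e1) => h.
  have := rmorph_delete_part (meval (fun=> 1 : int)) t 'X_0 'X_1 D2 e.
  by rewrite -/p0 h rmorph0 /= meval1 !mevalXU => <-.
have q0_neq0 : q0 != 0.
  apply: contraNneq (contract_part1_neq0 even2 e0 e1) => h.
  have := rmorph_contract_part (meval (fun=> 1 : int)) t 'X_0 'X_1 D2 e.
  by rewrite -/q0 h rmorph0 /= meval1 !mevalXU => <-.
clearbody p0 q0.
have pqE p q : pq_equations D2 e p q <-> emb p = emb p0 /\ emb q = emb q0.
  rewrite /pq_equations /tutte1 /sqxy embp embq.
  exact: (minor_equationsP x0 y0 _ _ xy1 even2 nonsing2).
(* Uniqueness, obtained in the fraction field, descends to the polynomial ring by injectivity of the
   embedding. *)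
have emb_inj p q : emb p = emb q -> p = q.
  by move/eqP; rewrite tofrac_eq => /eqP.
split.
  exists (p0, q0); split; first exact/pqE.
  by move=> [p q] /pqE [/emb_inj /= -> /emb_inj /= ->].
move=> p q /pqE [/emb_inj -> /emb_inj ->]; split=> //.
have ep0 : emb p0 != 0 by rewrite tofrac_eq0.
have eq0 : emb q0 != 0 by rewrite tofrac_eq0.
rewrite /tutte1 /sqxy.
exact: (tutte_tensor x0 y0 even1 even2 nonsing2 tensorD embp embq ep0 eq0).
Qed.
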